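(* Let $q$ be a prime power, $k\ge1$, and let $U$ be a $k\times m$ matrix over $\mathbb{F}_q$ whose columns form a maximal set of nonzero vectors of $\mathbb{F}_q^k$ no one of which is a scalar multiple of another. Then, up to isomorphism, $\mathfrak{g}_k(\mathbb{F}_q)$ is exactly the set of looped graphs $\Gamma(U^tBU)$ for $B\in\mathcal{B}$, where: (1) if $k$ is odd, $\mathcal{B}=\{I_k\}$; (2) if $k$ is even and $q$ is even, $\mathcal{B}=\{I_k,\operatorname{diag}(H,H,\dots,H)\}$ with $k/2$ copies of $H=\begin{bmatrix}0&1\\1&0\end{bmatrix}$; (3) if $k$ is even and $q$ is odd, $\mathcal{B}=\{I_k,\operatorname{diag}(I_{k-1},\nu)\}$ where $\nu$ is any nonsquare in $\mathbb{F}_q$.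
   Context: For a symmetric $n\times n$ matrix $A$, the looped graph corresponding to $A$, $\Gamma(A)$, has vertex set $\{1,\dots,n\}$, an edge $ij$ ($i\neq j$) iff $a_{ij}\neq0$, and a loop at $i$ iff $a_{ii}\ne 0$. Definition of $\mathfrak{g}_k(\mathbb{F}_q)$: let $x_1,\dots,x_m$ be representatives of the classes of nonzero vectors of $\mathbb{F}_q^k$ under the relation $x\sim cx$ ($c\in\mathbb{F}_q$, $c\neq0$), and let $U=[x_1\ \cdots\ x_m]$; $\mathfrak{g}_k(\mathbb{F}_q)$ is the set of isomorphism classes of looped graphs $\Gamma(U^tBU)$ as $B$ ranges over the invertible symmetric $k\times k$ matrices over $\mathbb{F}_q$. *)

(* Defs.v *)
From HB Require Import structures.
From mathcomp Require Import all_boot all_order all_algebra all_fingroup all_field.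
Set Implicit Arguments. Unset Strict Implicit. Unset Printing Implicit Defensive.
Import GRing.Theory.
Local Open Scope ring_scope.

(* Looped graph Gamma(A) of a square matrix A on vertex set 'I_m:
   i ~ j (for i <> j) iff A i j <> 0, loop at i iff A i i <> 0.
   Represented as a boolean relation on 'I_m (symmetric when A is). *)
Definition looped_graph (F : fieldType) (m : nat) (A : 'M[F]_m) : rel 'I_m :=
  fun i j => A i j != 0.

Definition lg_iso (m : nat) (G1 G2 : rel 'I_m) : Prop :=
  exists s : {perm 'I_m}, forall i j, G2 (s i) (s j) = G1 i j.

Definition proj_rep_matrix (F : fieldType) (k m : nat) (U : 'M[F]_(k, m)) : Prop :=
  [/\ forall j, col j U != 0,
      forall i j, i != j -> forall c : F, col i U != c *: col j U
    & forall v : 'cV[F]_k, v != 0 -> exists j, exists c : F, v = c *: col j U].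

Definition gamma_of (F : fieldType) (k m : nat) (U : 'M[F]_(k, m)) (B : 'M[F]_k)
  : rel 'I_m := looped_graph (U^T *m B *m U).

Definition inv_sym (F : fieldType) (k : nat) (B : 'M[F]_k) : Prop :=
  B^T = B /\ B \in unitmx.

(* diag(H, ..., H) with H = [[0,1],[1,0]] (meaningful for k even). *)
Definition hyp_blocks (F : fieldType) (k : nat) : 'M[F]_k :=
  \matrix_(i < k, j < k) (if (i != j :> nat) && ((i./2)%N == (j./2)%N) then 1 else 0).

Definition diag_nu (F : fieldType) (k : nat) (nu : F) : 'M[F]_k :=
  \matrix_(i < k, j < k)
     (if i == j then (if (i : nat) == k.-1 then nu else 1) else 0).

Definition calB (F : finFieldType) (k : nat) (nu : F) (B : 'M[F]_k) : Prop :=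
  if odd k then B = 1%:M
  else if ~~ odd #|F| then B = 1%:M \/ B = hyp_blocks F k
  else B = 1%:M \/ B = diag_nu k nu.

(* Main.v *)
Require Import Defs.
From HB Require Import structures.
From mathcomp Require Import all_boot all_order all_algebra all_fingroup all_field.
From mathcomp Require Import zify.
(** Columns of [U] are representatives of the points of projective space, so
  replacing [B] by [c *: (P *m B *m P^T)] only permutes the vertices of
  [Gamma(U^T B U)]; hence it suffices to classify the invertible symmetric
  matrices up to congruence and scaling.

  In odd characteristic a form [a x^2 + b y^2] with [a, b != 0] represents 1 (the
  sets [a x^2] and [1 - b y^2] each fill more than half of the field), so
  splitting off vectors of value 1 gives [B ~ diag(1, .., 1, d)], with [d]
  determined modulo squares.  For [k] odd, scaling [B] by [det B] makes its
  determinant a square.  In characteristic 2 every element is a square; an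
  alternating form is a sum of hyperbolic planes, and from any other form one
  splits off a vector of value 1, chosen so that its complement is again not
  alternating. *)

Set Implicit Arguments. Unset Strict Implicit. Unset Printing Implicit Defensive.
Import GRing.Theory.
Local Open Scope ring_scope.

(** * Congruence of matrices and orthogonal complements *)

Section Congruence.
Variable F : fieldType.

Definition mx_congr n (A B : 'M[F]_n) : Prop :=
  exists2 P : 'M[F]_n, P \in unitmx & B = P *m A *m P^T.

Lemma mx_congr_refl n (A : 'M[F]_n) : mx_congr A A.
Proof. by exists 1%:M; rewrite ?unitmx1 // trmx1 mul1mx mulmx1. Qed.

Lemma mx_congr_trans n (B A C : 'M[F]_n) :
  mx_congr A B -> mx_congr B C -> mx_congr A C.
Proof.
case=> P uP -> [Q uQ ->]; exists (Q *m P); first by rewrite unitmx_mul uQ.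
by rewrite trmx_mul !mulmxA.
Qed.

Lemma mx_congr_sym n (A B : 'M[F]_n) : mx_congr A B -> mx_congr B A.
Proof.
case=> P uP ->; exists (invmx P); rewrite ?unitmx_inv //.
by rewrite trmx_inv !mulmxA mulVmx // mul1mx mulmxK // unitmx_tr.
Qed.

Lemma mx_congr_inv_sym n (A B : 'M[F]_n) :
  mx_congr A B -> inv_sym A -> inv_sym B.
Proof.
case=> P uP -> [sA uA]; split; first by rewrite !trmx_mul trmxK sA mulmxA.
by rewrite !unitmx_mul uP uA unitmx_tr.
Qed.

Lemma mx_congr_block r n (A : 'M[F]_r) (B C : 'M[F]_n) :
  mx_congr B C -> mx_congr (block_mx A 0 0 B) (block_mx A 0 0 C).
Proof.
case=> P uP ->; exists (block_mx 1%:M 0 0 P).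
  by rewrite unitmxE det_ublock det1 mul1r -unitmxE.
by rewrite tr_block_mx !mulmx_block !trmx0 trmx1
  !(mulmx0, mul0mx, addr0, add0r, mul1mx, mulmx1).
Qed.

Lemma inv_sym_block_dr r n (A : 'M[F]_r) (B : 'M[F]_n) :
  inv_sym (block_mx A 0 0 B) -> inv_sym B.
Proof.
case=> s u; split; last first.
  by move: u; rewrite !unitmxE det_ublock unitrM => /andP[].
by move: s; rewrite tr_block_mx => /eq_block_mx[].
Qed.

(** The rows of [W] are a basis of the orthogonal complement of the rows of [V]. Since the Gram
    matrix of [V] is invertible, this complement has dimension [n] and meets the row space of [V]
    only in 0, so [V] stacked on [W] is a change of basis. *)
Lemma orthogonal_split r n (B : 'M[F]_(r + n)) (V : 'M[F]_(r, r + n)) :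
    B^T = B -> V *m B *m V^T \in unitmx ->
  exists W : 'M[F]_(n, r + n),
    [/\ mx_congr B (block_mx (V *m B *m V^T) 0 0 (W *m B *m W^T))
      & forall x : 'rV_(r + n), x *m B *m V^T = 0 -> exists y, x = y *m W].
Proof.
move=> sB uG; set G := V *m B *m V^T in uG *.
have rK : \rank (kermx (B *m V^T)) = n.
  have le : (\rank (B *m V^T) <= r)%N by rewrite rank_leq_col.
  have ge : (r <= \rank (B *m V^T))%N.
    by rewrite -{1}(mxrank_unit uG) /G -mulmxA mxrankM_maxr.
  by rewrite mxrank_ker; have/eqP -> : \rank (B *m V^T) == r;
    rewrite ?eqn_leq ?le ?ge // addKn.
have [W frW eqW] : exists2 W : 'M[F]_(n, r + n),
    row_free W & (W :=: kermx (B *m V^T))%MS.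
  (* [row_base K] has [\rank K] rows; with the row count generalized, eliminating the equation
     avoids a cast. *)
  have gen p q (K : 'M[F]_q) : \rank K = p ->
      exists2 W : 'M[F]_(p, q), row_free W & (W :=: K)%MS.
    case: _ /; exists (row_base K); [exact: row_base_free | exact: eq_row_base].
  exact: gen.
have WBV : W *m B *m V^T = 0.
  by rewrite -mulmxA; apply/sub_kermxP; rewrite eqW.
have VBW : V *m B *m W^T = 0.
  by apply: trmx_inj; rewrite !trmx_mul trmxK sB mulmxA WBV trmx0.
exists W; split; last first.
  move=> x; rewrite -mulmxA => /sub_kermxP; rewrite -eqW => /submxP[y ->].
  by exists y.
exists (col_mx V W); last first.
  by rewrite tr_col_mx mul_col_mx mul_col_row WBV VBW.
rewrite -row_free_unit; apply: inj_row_free => z.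
rewrite -[z]hsubmxK mul_row_col => z0.
(* Multiplying the relation by [B *m V^T] kills the [W] part and leaves [lsubmx z *m G]. *)
have a0 : lsubmx z = 0.
  have := congr1 (fun t => t *m B *m V^T) z0.
  rewrite /= !mulmxDl -!(mulmxA (lsubmx z)) -!(mulmxA (rsubmx z)) WBV !mul0mx.
  rewrite mulmx0 addr0 -/G => e.
  by rewrite -[lsubmx z](mulmxK uG) e mul0mx.
have b0 : rsubmx z = 0.
  by apply: (row_free_inj frW); rewrite mul0mx -z0 a0 mul0mx add0r.
by rewrite a0 b0 row_mx0.
Qed.

End Congruence.

(** * Effect of congruence and scaling on the graph *)

Section Graphs.
Variables (F : fieldType) (k m : nat) (U : 'M[F]_(k, m)).

Lemma lg_iso_trans (G1 G2 G3 : rel 'I_m) :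
  lg_iso G1 G2 -> lg_iso G2 G3 -> lg_iso G1 G3.
Proof.
case=> s hs [t ht]; exists (s * t)%g => i j.
by rewrite !permM ht hs.
Qed.

Lemma gamma_ofE (B : 'M[F]_k) i j :
  gamma_of U B i j = (((col i U)^T *m B *m col j U) 0 0 != 0).
Proof.
rewrite /gamma_of /looped_graph tr_col -row_mul [in LHS]mxE [in RHS]mxE.
by congr (_ != 0); apply: eq_bigr => l _; rewrite [row _ _ _ _]mxE [col _ _ _ _]mxE.
Qed.

(** [P^T] sends column [j] to a nonzero multiple of column [s j], with [s] a permutation. Each entry
    is then a nonzero multiple of the entry at the permuted indices. *)
Lemma gamma_of_congr (B : 'M[F]_k) (P : 'M[F]_k) (c : F) :
    proj_rep_matrix U -> P \in unitmx -> c != 0 ->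
  lg_iso (gamma_of U (c *: (P *m B *m P^T))) (gamma_of U B).
Proof.
case=> nz ind cov uP c0.
have uPT : P^T \in unitmx by rewrite unitmx_tr.
have nzP j : P^T *m col j U != 0.
  apply: contra (nz j) => /eqP e.
  by rewrite -[col j U](mulKmx uPT) e mulmx0.
(* Proportionality is put as a boolean inclusion of row spaces, so that [xchoose] can pick the
   index. *)
have ex j : exists i, ((P^T *m col j U)^T <= (col i U)^T)%MS.
  have [i [a e]] := cov _ (nzP j).
  by exists i; apply/sub_rVP; exists a; rewrite e linearZ.
pose s j := xchoose (ex j).
have sP j : exists2 a : F, a != 0 & P^T *m col j U = a *: col (s j) U.
  have /sub_rVP[a /(congr1 trmx)] := xchooseP (ex j).
  rewrite linearZ /= !trmxK => e; exists a => //.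
  by apply: contra (nzP j) => /eqP a0; rewrite e a0 scale0r.
have s_inj : injective s.
  move=> i j e; apply/eqP/negP => /negP ne.
  have [a a0 ea] := sP i; have [b b0 eb] := sP j.
  have /eqP[] := ind _ _ ne (a / b).
  rewrite -[col i U](mulKmx uPT) ea e -(mulKmx uPT (col j U)) eb.
  by rewrite -!scalemxAr scalerA divfK.
exists (perm s_inj) => i j; rewrite !permE !gamma_ofE.
have [a a0 ea] := sP i; have [b b0 eb] := sP j.
have -> : (col i U)^T *m (c *: (P *m B *m P^T)) *m col j U
     = c *: ((P^T *m col i U)^T *m B *m (P^T *m col j U)).
  by rewrite trmx_mul trmxK -scalemxAr -scalemxAl !mulmxA.
rewrite ea eb [(a *: _)^T]linearZ /= -!scalemxAl -scalemxAr !scalerA [in RHS]mxE.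
by rewrite !mulf_eq0 (negPf c0) (negPf a0) (negPf b0).
Qed.
End Graphs.

(** * Splitting symmetric forms over a field *)

Section Forms.
Variable F : fieldType.

Lemma mx11_mul (A B : 'M[F]_1) : (A *m B) 0 0 = A 0 0 * B 0 0.
Proof. by rewrite mxE big_ord1. Qed.

Lemma mx11_eq (A B : 'M[F]_1) : A 0 0 = B 0 0 -> A = B.
Proof. by move=> e; apply/matrixP=> i j; rewrite !ord1. Qed.

Lemma scalar_form n (B : 'M[F]_n) (v : 'rV_n) (c : F) :
  (c *: v) *m B *m (c *: v)^T = c ^+ 2 *: (v *m B *m v^T).
Proof. by rewrite [(c *: v)^T]linearZ /= -scalemxAr -!scalemxAl scalerA. Qed.

Lemma unitmx11 (A : 'M[F]_1) : (A \in unitmx) = (A 0 0 != 0).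
Proof. by rewrite unitmxE {1}[A]mx11_scalar det_scalar1 unitfE. Qed.

Lemma unit_row_pairing n (B : 'M[F]_n) (u : 'rV_n) :
  B \in unitmx -> u != 0 -> exists y : 'rV_n, u *m B *m y^T = 1%:M.
Proof.
move=> uB u0; have : u *m B != 0.
  by apply: contra u0 => /eqP e; rewrite -(mulmxK uB u) e mul0mx.
move: (u *m B) => w /rV0Pn[i nz]; exists ((w 0 i)^-1 *: delta_mx 0 i).
apply: mx11_eq; rewrite linearZ /= trmx_delta -scalemxAr -colE !mxE eqxx.
by rewrite mulVf.
Qed.

(** The last clause transfers values on the complement of [v] to [B']; it serves to show that [B']
    is not alternating. *)
Lemma mx_congr_split1 n (B : 'M[F]_(1 + n)) (v : 'rV_(1 + n)) :
    inv_sym B -> v *m B *m v^T = 1%:M ->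
  exists B' : 'M[F]_n, [/\ inv_sym B', mx_congr B (block_mx 1%:M 0 0 B')
   & forall x : 'rV_(1 + n), v *m B *m x^T = 0 ->
       exists y, x *m B *m x^T = y *m B' *m y^T].
Proof.
move=> [sB uB] q1; have := @orthogonal_split F 1 n B v sB.
rewrite q1 unitmx1 => /(_ isT)[W [cB spW]]; exists (W *m B *m W^T).
split=> //; first by apply: inv_sym_block_dr (mx_congr_inv_sym cB _); split.
move=> x vx; have [|y ->] := spW x; last by exists y; rewrite trmx_mul !mulmxA.
by apply: trmx_inj; rewrite !trmx_mul trmxK sB mulmxA vx trmx0.
Qed.

Lemma diag_nu_block n (nu : F) : (0 < n)%N ->
  diag_nu (1 + n) nu = block_mx 1%:M 0 0 (diag_nu n nu).
Proof.
case: n => // n _; apply/matrixP => i j; rewrite mxE.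
case: (split_ordP i) => i' ->; case: (split_ordP j) => j' ->.
- by rewrite block_mxEul !ord1 /= !mxE eqxx.
- by rewrite block_mxEur mxE -val_eqE /= !ord1.
- by rewrite block_mxEdl mxE -val_eqE /= !ord1.
by rewrite block_mxEdr mxE -!val_eqE /= !eqSS.
Qed.

Lemma det_diag_nu n (nu : F) : (0 < n)%N -> \det (diag_nu n nu) = nu.
Proof.
elim: n => // -[|n] IH _.
  by rewrite {1}[diag_nu 1 nu]mx11_scalar det_scalar1 mxE.
by rewrite -[n.+2]/(1 + n.+1)%N diag_nu_block // det_ublock det1 mul1r IH.
Qed.

Lemma diag_nu1 n : diag_nu n 1 = 1%:M :> 'M[F]_n.
Proof. by apply/matrixP => i j; rewrite !mxE if_same; case: eqP. Qed.

Lemma diag_nu_inv_sym n (nu : F) : (0 < n)%N -> nu != 0 -> inv_sym (diag_nu n nu).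
Proof.
move=> n0 nu0; split; last by rewrite unitmxE det_diag_nu // unitfE.
by apply/matrixP => i j; rewrite !mxE eq_sym; case: eqP => // ->.
Qed.

(** Rescale the last basis vector by [b]: only the class of the last entry modulo squares
    matters. *)
Lemma diag_nu_congr n (a b : F) : (0 < n)%N -> b != 0 ->
  mx_congr (diag_nu n a) (diag_nu n (b ^+ 2 * a)).
Proof.
elim: n => // -[|n] IH _ b0.
  exists b%:M; first by rewrite unitmx11 mxE.
  by apply: mx11_eq; rewrite tr_scalar_mx !mx11_mul !mxE /= mulr1n [RHS]mulrAC expr2.
rewrite -[n.+2]/(1 + n.+1)%N !(@diag_nu_block n.+1) //.
by apply: mx_congr_block; apply: IH.
Qed.

Lemma hyp_blocks_block n :
  hyp_blocks F (2 + n) = block_mx (hyp_blocks F 2) 0 0 (hyp_blocks F n).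
Proof.
apply/matrixP => i j; rewrite mxE.
case: (split_ordP i) => i' ->; case: (split_ordP j) => j' ->.
- by rewrite block_mxEul mxE.
- by rewrite block_mxEur mxE /=; case: i' => -[|[|]].
- by rewrite block_mxEdl mxE /=; case: j' => -[|[|]] //=; rewrite andbF.
by rewrite block_mxEdr mxE.
Qed.

Lemma hyp_blocks2 (A : 'M[F]_(1 + 1)) :
  A = block_mx 0 1%:M 1%:M 0 -> A = hyp_blocks F 2.
Proof.
move=> ->; apply/matrixP => i j; rewrite [RHS]mxE.
by case: (split_ordP i) => i' ->; case: (split_ordP j) => j' ->;
  rewrite ?(block_mxEul, block_mxEur, block_mxEdl, block_mxEdr) !ord1 mxE.
Qed.

Lemma hyp_blocks_inv_sym n : ~~ odd n -> inv_sym (hyp_blocks F n).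
Proof.
move=> en; split.
  by apply/matrixP => i j; rewrite !mxE eq_sym [(i./2 == _)%N]eq_sym.
have [k] := ubnP n; elim: k n en => // k IH [|[|n]] // en ltn.
  by rewrite unitmxE det_mx00 unitr1.
rewrite -[n.+2]/(2 + n)%N unitmxE hyp_blocks_block det_ublock unitrM -!unitmxE (IH n) ?andbT //.
- rewrite -[hyp_blocks F 2](hyp_blocks2 (erefl _)).
  (* [H] is its own inverse. *)
  have [] // := @mulmx1_unit F (1 + 1) (block_mx 0 1%:M 1%:M 0) (block_mx 0 1%:M 1%:M 0).
  rewrite mulmx_block !mulmx0 !mulmx1 !(add0r, addr0).
  by rewrite [RHS]scalar_mx_block.
- by move: en; rewrite /= negbK.
- exact: ltn_trans (ltnSn _) _.
Qed.

(** A nonzero [v] and a [w] paired with it to 1 have Gram matrix [H]; splitting off their plane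
    lowers the dimension by 2. Dimension 1 cannot be reached, its alternating form being zero, so
    [n] is even. *)
Lemma alternating_congr_hyp n (B : 'M[F]_n) : inv_sym B ->
    (forall v : 'rV_n, v *m B *m v^T = 0) ->
  ~~ odd n /\ mx_congr B (hyp_blocks F n).
Proof.
have [k] := ubnP n; elim: k n B => // k IH [|[|n]] B ltn [sB uB] alt.
- by split=> //; rewrite [B]flatmx0 [hyp_blocks _ _]flatmx0; apply: mx_congr_refl.
- have := alt 1%:M; rewrite trmx1 mulmx1 mul1mx => B0.
  by move: uB; rewrite B0 unitmx11 mxE eqxx.
have v0 : delta_mx 0 0 != 0 :> 'rV[F]_(2 + n).
  by apply/rV0Pn; exists 0; rewrite mxE eqxx oner_eq0.
have [w vw] := unit_row_pairing uB v0.
set v := delta_mx 0 0 in v0 vw.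
have wv : w *m B *m v^T = 1%:M.
  by apply: trmx_inj; rewrite !trmx_mul trmxK sB mulmxA vw trmx1.
pose V : 'M[F]_(1 + 1, 2 + n) := col_mx v w.
have G : V *m B *m V^T = hyp_blocks F 2.
  apply: hyp_blocks2.
  by rewrite /V tr_col_mx mul_col_mx mul_col_row !alt vw wv.
have [_ uH] := @hyp_blocks_inv_sym 2 isT.
have := @orthogonal_split F 2 n B V sB; rewrite G => /(_ uH)[W [cB _]].
have iW : inv_sym (W *m B *m W^T).
  by apply: inv_sym_block_dr (mx_congr_inv_sym cB _); split.
have [| |en cW] := IH n _ _ iW.
- exact: ltn_trans (ltnSn _) _.
- by move=> x; have := alt (x *m W); rewrite trmx_mul !mulmxA.
split; first by rewrite /= negbK.
by apply: mx_congr_trans cB _; rewrite -[n.+2]/(2 + n)%N hyp_blocks_block; apply: mx_congr_block.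
Qed.


(** Polarization: if [u] and [y] pair to 1 and both have value 0, then [u + y] has value 2. *)
Lemma form_nonzero_value n (B : 'M[F]_n) : (2%:R != 0 :> F) -> (0 < n)%N ->
  inv_sym B -> exists v : 'rV_n, (v *m B *m v^T) 0 0 != 0.
Proof.
move=> two0 n0 [sB uB].
have u0 : const_mx 1 != 0 :> 'rV[F]_n.
  by apply/rV0Pn; exists (Ordinal n0); rewrite mxE oner_eq0.
move: (const_mx 1) u0 => u u0; have [y uy] := unit_row_pairing uB u0.
have yu : y *m B *m u^T = 1%:M.
  by apply: trmx_inj; rewrite !trmx_mul trmxK sB mulmxA uy trmx1.
have [qu|] := eqVneq ((u *m B *m u^T) 0 0) 0; last by exists u.
have [qy|] := eqVneq ((y *m B *m y^T) 0 0) 0; last by exists y.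
exists (u + y); rewrite linearD /= !(mulmxDl, mulmxDr) uy yu.
by rewrite mxE [X in X + _]mxE [X in _ + X]mxE qu qy !mxE eqxx add0r addr0.
Qed.

Lemma rescale_form n (B : 'M[F]_n) (v : 'rV_n) (c : F) :
  c ^+ 2 * (v *m B *m v^T) 0 0 = 1 -> (c *: v) *m B *m (c *: v)^T = 1%:M.
Proof. by move=> e; apply: mx11_eq; rewrite scalar_form mxE e mxE. Qed.

Lemma inv_sym_scale n (B : 'M[F]_n) (c : F) :
  c != 0 -> inv_sym B -> inv_sym (c *: B).
Proof.
move=> c0 [sB uB]; split; first by rewrite linearZ /= sB.
by rewrite unitmxZ // unitfE.
Qed.

End Forms.

(** * Squares and symmetric forms over finite fields *)

Section FiniteFields.
Variable F : finFieldType.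

Lemma pchar2_odd_card : (2%N \in [pchar F]) = ~~ odd #|F|.
Proof.
have [p pr_p pF] := finPcharP F.
have cF : #|F| = (p ^ logn p #|F|)%N := card_pprimeChar pF.
have l0 : (0 < logn p #|F|)%N.
  by rewrite lt0n; apply: contraTneq (finNzRing_gt1 F) => l0; rewrite cF l0.
apply/idP/idP => [F2|].
  move: F2; rewrite (pcharf_eq pF) inE => /eqP p2.
  by rewrite cF oddX negb_or -lt0n l0 -p2.
rewrite cF oddX negb_or => /andP[_ ep].
by have [<-|op] := even_prime pr_p; rewrite // op in ep.
Qed.

(** The Frobenius map is injective, hence bijective on a finite field. *)
Lemma pchar2_square (a : F) : 2%N \in [pchar F] -> exists x, x ^+ 2 = a.
Proof.
move=> F2; have [g _ gK] := injF_bij (fmorph_inj (pFrobenius_aut F2)).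
by exists (g a); rewrite -(pFrobenius_autE F2); apply: gK.
Qed.

(** Fibres of [x |-> a * x ^+ 2] have at most two elements, [x0] and [- x0], which gives the weak
    inequality; equality would make [#|F|] even. *)
Lemma card_scaled_squares (a : F) : odd #|F| -> a != 0 ->
  (#|F| < 2 * #|[set (a * x ^+ 2)%R | x in F]|)%N.
Proof.
move=> oF a0; rewrite ltn_neqAle; apply/andP; split.
  by apply: contraTneq oF => ->; rewrite oddM.
rewrite -[in X in (X <= _)%N]sum1_card mulnC -sum_nat_const.
rewrite (partition_big_imset (fun x => a * x ^+ 2)) /=.
apply: leq_sum => _ /imsetP[x0 _ ->]; rewrite sum1dep_card.
apply: leq_trans (_ : #|[set x0; - x0]| <= 2)%N; last by rewrite cards2; case: eqP.
apply/subset_leq_card/subsetP => x; rewrite !inE => /eqP/(mulfI a0)/eqP.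
by rewrite eqf_sqr.
Qed.

Lemma binary_form_represents1 (a b : F) : odd #|F| -> a != 0 -> b != 0 ->
  exists x y, a * x ^+ 2 + b * y ^+ 2 = 1.
Proof.
move=> oF a0 b0.
pose A := [set a * x ^+ 2 | x in F]; pose B := [set b * x ^+ 2 | x in F].
pose B' := [set 1 - t | t in B].
have cA := card_scaled_squares oF a0; have cB := card_scaled_squares oF b0.
have cB' : #|B'| = #|B| by apply: card_imset; exact: subrI.
have : (0 < #|A :&: B'|)%N.
  have := cardsUI A B'; have := subset_leq_card (subsetT (A :|: B')).
  rewrite cB' cardsT; move: cA cB; rewrite -/A -/B.
  by move: #|F| #|A| #|B| #|_ :|: _| #|_ :&: _|; lia.
case/card_gt0P => t /setIP[/imsetP[x _ ->] /imsetP[_ /imsetP[y _ ->] e]].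
by exists x, y; rewrite e subrK.
Qed.

(** Squares and [nu]-multiples of squares each fill more than half of the field and share at most 0,
    so together they have at least [#|F|] elements. *)
Lemma square_classes (nu d : F) : odd #|F| -> (forall x, x * x != nu) ->
  exists x, d = x ^+ 2 \/ d = x ^+ 2 * nu.
Proof.
move=> oF nuP; have nu0 : nu != 0 by rewrite eq_sym -(mul0r 0).
pose A := [set 1 * x ^+ 2 | x in F]; pose B := [set nu * x ^+ 2 | x in F].
have cA := card_scaled_squares oF (oner_neq0 F); have cB := card_scaled_squares oF nu0.
have AB : A :&: B \subset [set 0].
  apply/subsetP => _ /setIP[/imsetP[x _ ->] /imsetP[y _]]; rewrite mul1r inE => e.
  have [y0|y0] := eqVneq y 0; first by rewrite e y0 expr0n mulr0.
  by have /eqP[] := nuP (x / y); rewrite mulf_div -!expr2 e mulfK // expf_neq0.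
have cAB := subset_leq_card AB; rewrite cards1 in cAB.
have : A :|: B = [set: F].
  apply/eqP; rewrite eqEcard subsetT cardsT; have := cardsUI A B.
  move: cA cB cAB; rewrite -/A -/B.
  by move: #|F| #|A| #|B| #|_ :|: _| #|_ :&: _|; lia.
move/setP/(_ d); rewrite !inE => /orP[] /imsetP[x _ ->]; exists x.
  by left; rewrite mul1r.
by right; rewrite mulrC.
Qed.

Lemma nonalternating_congr1 n (B : 'M[F]_n) : 2%N \in [pchar F] -> inv_sym B ->
  (exists v : 'rV_n, v *m B *m v^T != 0) -> mx_congr B 1%:M.
Proof.
move=> F2; elim: n B => [|n IH] B iB [v qv].
  by rewrite [B]flatmx0 [1%:M]flatmx0; apply: mx_congr_refl.
rewrite -[n.+1]/(1 + n)%N in B iB v qv *.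
have [w qw] : exists w : 'rV_(1 + n), w *m B *m w^T = 1%:M.
  have [x ex] := pchar2_square ((v *m B *m v^T) 0 0)^-1 F2.
  exists (x *: v); apply: rescale_form; rewrite ex mulVf //.
  by apply: contra qv => /eqP e; apply/eqP/mx11_eq; rewrite e mxE.
(* The induction needs a complement that is again not alternating; in dimension 0 there is no such
   form, but nothing is left to prove. *)
suff [B' [iB' cB nB']] : exists B' : 'M_n, [/\ inv_sym B',
    mx_congr B (block_mx 1%:M 0 0 B')
    & n = 0%N \/ exists v : 'rV_n, v *m B' *m v^T != 0].
  apply: mx_congr_trans cB _; rewrite [X in mx_congr _ X]scalar_mx_block.
  apply: mx_congr_block; case: nB' => [n0|]; last exact: IH.
  move: B' {iB'}; rewrite n0 => B'.
  by rewrite [B']flatmx0 [1%:M]flatmx0; apply: mx_congr_refl.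
have [B0 [iB0 cB0 _]] := mx_congr_split1 iB qw.
case: (boolP [exists v : 'rV_n, v *m B0 *m v^T != 0]) => [/existsP nB0|].
  by exists B0; split=> //; right.
rewrite negb_exists => /forallP alt0.
have alt (u : 'rV_n) : u *m B0 *m u^T = 0 by have := alt0 u; rewrite negbK => /eqP.
have [n0|n0] := posnP n; first by exists B0; split=> //; left.
have u0 : const_mx 1 != 0 :> 'rV[F]_n.
  by apply/rV0Pn; exists (Ordinal n0); rewrite mxE oner_eq0.
move: (const_mx 1) u0 => u u0; have [y uy] := unit_row_pairing iB0.2 u0.
(* The complement of [w] is alternating.  Use the vector [(1, u)], of value 1,
   instead: [(-1, y)] is orthogonal to it and has value 1. *)
have iC := mx_congr_inv_sym cB0 iB.
have blockE (a b : 'rV_1) (s t : 'rV_n) :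
    row_mx a s *m block_mx 1%:M 0 0 B0 *m (row_mx b t)^T = a *m b^T + s *m B0 *m t^T.
  by rewrite tr_row_mx mul_row_block !mulmx0 mulmx1 addr0 add0r mul_row_col.
have [|B1 [iB1 cB1 sp]] := mx_congr_split1 (v := row_mx 1%:M u) iC.
  by rewrite blockE alt trmx1 mulmx1 addr0.
exists B1; split=> //; first exact: mx_congr_trans cB0 cB1.
right; have [|z ez] := sp (row_mx (- 1%:M) y).
  by rewrite blockE uy linearN /= trmx1 mulmxN mulmx1 addNr.
exists z; rewrite -ez blockE alt addr0 linearN /= trmx1 mulmxN mulmx1 opprK.
by apply/eqP => /matrixP/(_ 0 0)/eqP; rewrite !mxE oner_eq0.
Qed.

Lemma inv_sym_congr_diag_nu n (B : 'M[F]_n) : odd #|F| -> (0 < n)%N -> inv_sym B ->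
  exists2 d, d != 0 & mx_congr B (diag_nu n d).
Proof.
move=> oF; have two0 : 2%:R != 0 :> F.
  by have := pchar2_odd_card; rewrite oF inE /= => /negbT.
elim: n B => // -[|n] IH B _ iB.
  exists (B 0 0); first by rewrite -unitmx11; case: iB.
  suff <- : B = diag_nu 1 (B 0 0) by apply: mx_congr_refl.
  by apply: mx11_eq; rewrite mxE.
rewrite -[n.+2]/(1 + n.+1)%N in B iB *.
suff [B' iB' cB] : exists2 B' : 'M_n.+1, inv_sym B' & mx_congr B (block_mx 1%:M 0 0 B').
  have [d d0 cB'] := IH _ isT iB'; exists d => //.
  by apply: mx_congr_trans cB _; rewrite diag_nu_block //; apply: mx_congr_block.
(* Two orthogonal vectors with nonzero values [a] and [b] are found first; a combination with
   coefficients [x], [y] has value [a * x ^+ 2 + b * y ^+ 2], which can be made 1. *)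
have [v qv] := form_nonzero_value two0 (ltn0Sn _) iB.
have uG : v *m B *m v^T \in unitmx by rewrite unitmx11.
have [W [cB _]] := orthogonal_split (r := 1) iB.1 uG.
have iC := mx_congr_inv_sym cB iB.
have [w qw] := form_nonzero_value two0 (ltn0Sn _) (inv_sym_block_dr iC).
have [x [y e]] := binary_form_represents1 oF qv qw.
move: (W *m B *m W^T) (v *m B *m v^T) cB iC w qv qw e {uG} => C a cB iC w qv qw e.
have [|B' [iB' cB' _]] := mx_congr_split1 (v := row_mx x%:M (y *: w)) iC.
  rewrite tr_row_mx mul_row_block !mulmx0 addr0 add0r mul_row_col scalar_form.
  apply: mx11_eq; rewrite tr_scalar_mx mxE !mx11_mul [X in _ + X = _]mxE.
  rewrite ![_%:M 0 0]mxE !mulr1n -e (mulrC (y ^+ 2)).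
  by rewrite mulrAC -expr2 (mulrC (x ^+ 2)).
by exists B' => //; apply: mx_congr_trans cB cB'.
Qed.

(** * Reduction to the representatives in [calB] *)

Lemma calB_inv_sym k (nu : F) (B : 'M[F]_k) : (0 < k)%N ->
    (~~ odd k -> odd #|F| -> nu != 0) -> calB nu B -> inv_sym B.
Proof.
move=> k0 nu0.
have i1 : inv_sym (1%:M : 'M[F]_k) by split; rewrite ?trmx1 ?unitmx1.
rewrite /calB; case: ifP => [_ -> //|/negbT ok].
case: ifP => [_|/negbFE oF] [] -> //; first exact: hyp_blocks_inv_sym.
by apply: diag_nu_inv_sym => //; apply: nu0.
Qed.

Lemma inv_sym_calB k (nu : F) (B : 'M[F]_k) : (0 < k)%N ->
    (~~ odd k -> odd #|F| -> forall x, x * x != nu) -> inv_sym B ->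
  exists B0 c, [/\ calB nu B0, c != 0 & mx_congr B0 (c *: B)].
Proof.
move=> k0 nuP iB; rewrite /calB; have [oF|eF] := boolP (odd #|F|); last first.
  have F2 : 2%N \in [pchar F] by rewrite pchar2_odd_card.
  case: (boolP [exists v : 'rV_k, v *m B *m v^T != 0]) => [/existsP nB|].
    exists 1%:M, 1; rewrite oner_neq0 scale1r; split=> //.
      by case: ifP => // _; left.
    by apply: mx_congr_sym; apply: nonalternating_congr1.
  rewrite negb_exists => /forallP alt.
  (* An alternating form forces [k] even, so for [k] odd only the identity arises. *)
  have [|ek cB] := alternating_congr_hyp iB.
    by move=> v; have := alt v; rewrite negbK => /eqP.
  exists (hyp_blocks F k), 1; rewrite oner_neq0 scale1r (negPf ek).
  by split=> //; [right | apply: mx_congr_sym].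
have [ok|ek] := boolP (odd k); last first.
  have [d d0 cB] := inv_sym_congr_diag_nu oF k0 iB.
  have [x dE] := square_classes d oF (nuP ek oF).
  have x0 : x != 0.
    by apply: contraNneq d0 => x0; case: dE => ->; rewrite x0 expr0n ?mul0r.
  case: dE => dE; [exists 1%:M, 1 | exists (diag_nu k nu), 1];
    rewrite oner_neq0 scale1r; split=> //; [by left | | by right |];
    apply: mx_congr_trans (mx_congr_sym cB); rewrite dE.
    by rewrite -diag_nu1 -[x ^+ 2]mulr1; apply: diag_nu_congr.
  exact: diag_nu_congr.
(* For [k] odd, [c *: B] has determinant [c ^+ k.+1], a square because [k.+1] is even; hence [d] is
   a square too and can be rescaled to 1. *)
pose c := \det B.
have c0 : c != 0 by rewrite -unitfE -unitmxE; case: iB.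
have [d d0 cB] := inv_sym_congr_diag_nu oF k0 (inv_sym_scale c0 iB).
exists 1%:M, c; split=> //; apply: mx_congr_trans (mx_congr_sym cB).
have [P uP /(congr1 determinant)] := cB.
rewrite det_diag_nu // !det_mulmx det_tr detZ -/c => dE.
have {dE} -> : d = (\det P * c ^+ (k./2.+1)) ^+ 2 * 1.
  rewrite dE mulr1 exprMn -exprM mulrAC -expr2 -exprSr; congr (_ * c ^+ _).
  by rewrite -{1}[k]odd_double_half ok muln2.
rewrite -diag_nu1; apply: diag_nu_congr => //.
by rewrite mulf_neq0 ?expf_neq0 // -unitfE -unitmxE.
Qed.

End FiniteFields.

Theorem mainTheorem2 (F : finFieldType) (k m : nat) (U : 'M[F]_(k, m)) (nu : F) :
  (0 < k)%N ->
  proj_rep_matrix U ->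
  (* in case (3) (k even, q = #|F| odd), nu is any nonsquare of F;
     in cases (1),(2) nu is unused *)
  (~~ odd k -> odd #|F| -> forall x : F, (x * x)%R != nu) ->
  forall G : rel 'I_m,
    (exists B : 'M[F]_k, inv_sym B /\ lg_iso G (gamma_of U B)) <->
    (exists B : 'M[F]_k, calB nu B /\ lg_iso G (gamma_of U B)).
Proof.
move=> k0 repU nuP G; split=> -[B [hB isoG]]; last first.
  exists B; split=> //; apply: calB_inv_sym hB => // ek oF.
  by rewrite eq_sym -(mul0r 0); apply: nuP.
have [B0 [c [hB0 c0 [P uP cB]]]] := inv_sym_calB k0 nuP hB.
exists B0; split=> //; apply: lg_iso_trans isoG _.
have -> : B = c^-1 *: (P *m B0 *m P^T) by rewrite -cB scalerA mulVf // scale1r.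
by apply: gamma_of_congr; rewrite ?invr_eq0.
Qed.
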